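(* Let $p$ be a prime and let $q$ be an odd prime that divides $p-1$. Then there exists a finite solvable group $G$ with $\mathrm{dl}(G)=4$, Fitting height $3$, and $$\mathrm{cd}(G)=\Big\{1,\ q,\ \Big(\tfrac{p^q-1}{p-1}\Big)_{q'}(p-1)_q\,q,\ p^q\Big(\tfrac{p^q-1}{p-1}\Big)_{q'}(p-1)_q\,q\Big\}.$$
   Context: $\mathrm{cd}(G)$ is the set of degrees of irreducible complex characters of $G$, and $\mathrm{dl}(G)$ is the derived length of $G$. For a positive integer $N$ and a prime $q$, $N_q$ denotes the largest power of $q$ dividing $N$, and $N_{q'}=N/N_q$. *)

(* Defs.v *)
From mathcomp Require Import all_boot all_order all_algebra all_fingroup all_solvable all_field all_character.
Local Open Scope ring_scope.
Set Implicit Arguments. Unset Strict Implicit. Unset Printing Implicit Defensive.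
Import GroupScope GRing.Theory Num.Theory.

Fixpoint upper_Fitting (gT : finGroupType) (G : {set gT}) (n : nat) : {set gT} :=
  if n is m.+1 then coset (upper_Fitting G m) @*^-1 'F(G / upper_Fitting G m)
  else 1.

Definition derived_length_is (gT : finGroupType) (G : {group gT}) (n : nat) : Prop :=
  G^`(n) = 1 /\ forall m, (m < n)%N -> G^`(m) != 1.

Definition Fitting_height_is (gT : finGroupType) (G : {group gT}) (n : nat) : Prop :=
  upper_Fitting G n = G /\ forall m, (m < n)%N -> upper_Fitting G m != G.

Definition in_cd (gT : finGroupType) (G : {group gT}) (x : algC) : Prop :=
  exists i : Iirr G, ('chi[G]_i 1%g)%R = x.

(* Main.v *)
From HB Require Import structures.
Require Import Defs.
From mathcomp Require Import all_boot all_order all_algebra all_fingroup all_solvable all_field all_character.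
From mathcomp Require Import zify ring.

(* With F = GF(p^q), let P be the Heisenberg group of order p^(3q) over F, and
   let H be a group of order N = n s q, where n = ((p^q-1)/(p-1))_{q'} and
   s = (p-1)_q, acting semilinearly on F: its i-th element is
   x |-> w^i x^(p^i), with w a primitive N-th root of unity in F. H acts on
   both noncentral coordinates of P by this map and on the central one by
   x |-> w^(2i) x^(p^i). This action is fixed-point-free: since
   (p^q-1)/(p-1) = q n and q | s, the order p^q-1 of the unit group divides
   (p-1) n s, so raising w^i x^(p^i) = x to the power n s gives w^(n s i) = 1;
   hence q | i, and then w^i = 1. As N is odd, the same holds with w^(2i) in
   place of w^i. So P ><| H is a Frobenius group, whose irreducible characters are
   those of H, of degree 1 or q since H has an abelian normal subgroup of
   index q, and the induced characters of degree |H| theta(1), where theta(1)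
   is 1 or p^q. *)

Set Implicit Arguments. Unset Strict Implicit. Unset Printing Implicit Defensive.
Import GroupScope GRing.Theory Num.Theory.

(** * Divisibility properties of [(p^q - 1)/(p - 1)] *)

Section RepunitArithmetic.

Local Open Scope nat_scope.
Variables p q : nat.
Hypotheses (p_pr : prime p) (q_pr : prime q) (q_odd : odd q) (q_dv : q %| p - 1).

Let E := (p ^ q - 1) %/ (p - 1).

Lemma gt_prime_dvd_pred : q < p.
Proof.
by have := dvdn_leq _ q_dv; have := prime_gt1 p_pr; lia.
Qed.

Lemma expn_sub1_repunit : p ^ q - 1 = (p - 1) * E.
Proof. by rewrite mulnC divnK // -{2}(exp1n q) subn_exp dvdn_mulr. Qed.

Lemma repunit_sum : E = \sum_(i < q) p ^ i.
Proof.
have p1_gt0: 0 < p - 1 by have := prime_gt1 p_pr; lia.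
apply/eqP; rewrite -(eqn_pmul2l p1_gt0) -expn_sub1_repunit -{1}(exp1n q) subn_exp.
apply/eqP; congr (_ * _); rewrite (reindex_inj rev_ord_inj) /=.
apply: eq_bigr => i _; rewrite exp1n muln1; congr (p ^ _); have := ltn_ord i; lia.
Qed.

Lemma expn_mod_pred i : p ^ i = 1 %[mod p - 1].
Proof.
have p_gt1 := prime_gt1 p_pr; rewrite -modnXm.
by rewrite -{1}(subnK (ltnW p_gt1)) modnDl modnXm exp1n.
Qed.

Lemma repunit_mod : E = q %[mod p - 1].
Proof.
rewrite repunit_sum -modn_summ; under eq_bigr do rewrite expn_mod_pred.
by rewrite modn_summ sum1_card card_ord.
Qed.

(* [p ^ i = 1 + i (p - 1)] modulo [q ^ 2], and [q] odd kills the sum of the [i (p - 1)]. *)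
Lemma repunit_mod_sq : E = q %[mod q ^ 2].
Proof.
have p_gt1 := prime_gt1 p_pr.
have pE: p = (p - 1) + 1 by rewrite subnK // ltnW.
have expE i: p ^ i = i * (p - 1) + 1 %[mod q ^ 2].
  elim: i => [//|i IH]; rewrite expnS -modnMmr IH modnMmr {1}pE.
  have ->: (p - 1 + 1) * (i * (p - 1) + 1) = i * (p - 1) ^ 2 + (i.+1 * (p - 1) + 1).
    by rewrite -mulnn; lia.
  by rewrite -modnDml; case/dvdnP: q_dv => t ->; rewrite expnMn mulnA modnMl.
rewrite repunit_sum -modn_summ; under eq_bigr do rewrite expE.
rewrite modn_summ big_split /= sum1_card card_ord -big_distrl /=.
rewrite -(big_mkord predT id) bin2_sum bin2odd // -mulnA.
have [t ->] := dvdnP q_dv; set h := _./2.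
have ->: q * (h * (t * q)) = h * t * q ^ 2 by rewrite -mulnn mulnC -!mulnA.
by rewrite modnMDl.
Qed.

(** By [repunit_mod_sq], [q] divides [E] but [q ^ 2] does not. *)
Lemma repunit_part : E`_q = q.
Proof.
have q_gt1 := prime_gt1 q_pr.
have qq: q ^ 1 < q ^ 2 by rewrite ltn_exp2l.
have E_gt0: 0 < E.
  rewrite lt0n; apply/eqP=> E0; have:= repunit_mod_sq; rewrite E0 mod0n modn_small; lia.
have dv1: q ^ 1 %| E.
  have q_dv2: q %| q ^ 2 by apply: dvdn_mulr.
  by rewrite expn1 /dvdn -(modn_dvdm E q_dv2) repunit_mod_sq modn_dvdm // modnn.
have dv2: ~~ (q ^ 2 %| E).
  by rewrite /dvdn repunit_mod_sq modn_small // -lt0n; lia.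
rewrite p_part; move: dv1 dv2; rewrite !pfactor_dvdn //.
by case: (logn q E) => [|[|k]] //; rewrite expn1.
Qed.

Let n := E`_q^'.
Let s := (p - 1)`_q.

Lemma repunitE : E = q * n.
Proof.
have E_gt0: 0 < E.
  rewrite lt0n; apply/eqP=> E0; have := prime_gt1 q_pr.
  by have := repunit_part; rewrite E0 partn0 => <-.
by rewrite -{1}(partnC q E_gt0) repunit_part.
Qed.

Lemma dvd_part_pred : q %| s.
Proof.
have p1_gt0: 0 < p - 1 by have := prime_gt1 p_pr; lia.
rewrite /s p_part -{1}(expn1 q) dvdn_exp2l //.
by rewrite -pfactor_dvdn // expn1.
Qed.

Lemma repunit_order_dvd : n * s * q %| p ^ q - 1.
Proof.
rewrite expn_sub1_repunit repunitE mulnAC (mulnC n) mulnC.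
by apply: dvdn_mul; rewrite ?dvdn_part.
Qed.

Lemma repunit_dvd_order : p ^ q - 1 %| (p - 1) * (n * s).
Proof.
by rewrite expn_sub1_repunit repunitE dvdn_mul // mulnC dvdn_mul // dvd_part_pred.
Qed.

(** [E] is a sum of [q] odd terms with [q] odd, and [s] is a power of [q]. *)
Lemma odd_repunit_order : odd (n * s * q).
Proof.
have p_odd: odd p.
  case: (even_prime p_pr) => // p2; move: q_dv; rewrite p2 dvdn1 => /eqP q1.
  by have := prime_gt1 q_pr; rewrite q1.
have: odd E.
  rewrite repunit_sum; have ->: odd (\sum_(i < q) p ^ i) = odd q.
    elim: {+}q => [|k IH]; first by rewrite big_ord0.
    by rewrite big_ord_recr /= oddD oddX p_odd orbT addbT IH.
  by [].
rewrite repunitE oddM => /andP[_ n_odd].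
by rewrite !oddM n_odd q_odd /s p_part oddX q_odd orbT.
Qed.

(** A common prime divisor [r] divides [E], which is [q] modulo [p - 1], so [r = q]; but [q] does
    not divide a [q']-part. *)
Lemma coprime_repunit_part_pred : coprime n (p - 1).
Proof.
have [q_gt0 q_gt1] := (prime_gt0 q_pr, prime_gt1 q_pr).
have p1_gt0: 0 < p - 1 by have := prime_gt1 p_pr; lia.
rewrite /coprime; apply: contraT => g1.
have /pdivP[r r_pr r_dv]: 1 < gcdn n (p - 1).
  by have: 0 < gcdn n (p - 1) by [rewrite gcdn_gt0 p1_gt0 orbT]; lia.
have [rn rp]: r %| n /\ r %| p - 1 by apply/andP; rewrite -dvdn_gcd.
have: r %| q.
  rewrite /dvdn -(modn_dvdm q rp) -repunit_mod modn_dvdm // -/(dvdn r E).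
  by rewrite repunitE dvdn_mull.
rewrite dvdn_prime2 // => /eqP rq.
have := part_pnat q^' E; rewrite -/n => /(pnatP _ (part_gt0 _ _))/(_ r r_pr rn).
by rewrite rq !inE eqxx.
Qed.

(** The sum [E] contains the terms [1] and [p], so [q * n = E > p > q]. *)
Lemma repunit_part_gt1 : 1 < n.
Proof.
have ltqp := gt_prime_dvd_pred.
have: q < E; last by rewrite repunitE; have := prime_gt0 q_pr; nia.
have sum_gt k: 1 < k -> p < \sum_(i < k) p ^ i.
  by case: k => [|[|k]] // _; rewrite 2!big_ord_recl /= expn1; lia.
by rewrite repunit_sum (ltn_trans ltqp) ?sum_gt ?prime_gt1.
Qed.

End RepunitArithmetic.

(** * Fixed-point-free action and nilpotency *)

Section FixedPointFree.

Variable gT : finGroupType.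
Implicit Types (D G H K L : {group gT}).

(** If [[~ k, x] = [~ l, x]] then [k * l^-1] centralises [x]; so [k |-> [~ k, x]] is injective on
    the finite group [D], hence onto [D]. *)
Lemma sub_commg_cycle D x :
  x \in 'N(D) -> 'C_D[x] = 1 -> D \subset [~: D, <[x]>].
Proof.
move=> nDx regx; pose f k := [~ k, x].
have f_inj: {in D &, injective f}.
  move=> k l Dk Dl; rewrite /f !commgEr => /mulIg; rewrite !conjVg => /invg_inj eq_kl.
  apply/eqP; rewrite eq_mulgV1 -in_set1 -[[set 1]]/(1%g : {set gT}) -regx.
  rewrite inE groupM ?groupV //= cent1C; apply/cent1P/commgP/conjg_fixP.
  by rewrite conjgM eq_kl conjgK.
have sfD: f @: D \subset D.
  by apply/subsetP=> _ /imsetP[k Dk ->]; rewrite /f commgEl groupM ?groupV ?memJ_norm.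
have defD: f @: D = D by apply/eqP; rewrite eqEcard sfD card_in_imset /=.
rewrite -{1}defD.
by apply/subsetP=> _ /imsetP[k Dk ->]; rewrite mem_commg ?cycle_id.
Qed.

(** Here [D] lies in [[~: D, <[x]>]], hence in [[~: D, L]], which nilpotency of [L] allows only for
    the trivial subgroup. *)
Lemma nilpotent_fixfree L D x :
  nilpotent L -> D \subset L -> x \in L -> x \in 'N(D) -> 'C_D[x] = 1 -> D :=: 1.
Proof.
move=> /forallP/(_ D)/implyP nilL sDL Lx nDx /(sub_commg_cycle nDx) sD.
by apply/eqP/nilL; rewrite subsetI sDL (subset_trans sD) ?commgS ?cycle_subG.
Qed.

(** An element of ['F(G)] outside [K] centralises no nontrivial element of [K]; as [K] also lies in
    the nilpotent group ['F(G)], [nilpotent_fixfree] would make [K] trivial. *)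
Lemma Frobenius_Fitting G K H :
  [Frobenius G = K ><| H] -> nilpotent K -> 'F(G) = K.
Proof.
move=> frobG nilK; have [defG ntK _ _ _] := Frobenius_context frobG.
have [nsKG _ _ _ _] := sdprod_context defG.
apply/eqP; rewrite eqEsubset (Fitting_max nsKG) // andbT; apply/subsetP=> x Fx.
apply: contraR ntK => notKx; apply/eqP.
have Gx := subsetP (Fitting_sub G) x Fx.
apply: (nilpotent_fixfree (Fitting_nil G) _ Fx); first by rewrite Fitting_max.
  exact: subsetP (normal_norm nsKG) x Gx.
apply/trivgP/subsetP=> k /setIP[Kk /cent1P cxk]; apply: contraR notKx => ntk.
have Kk1: k \in K^#.
  by rewrite !inE Kk andbT; apply: contraNneq ntk => ->; apply: group1.
by apply: (subsetP (Frobenius_cent1_ker frobG Kk1)); rewrite inE Gx; apply/cent1P.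
Qed.

End FixedPointFree.

(** * Degrees of irreducible characters *)

Section Degrees.

Local Open Scope ring_scope.
Variable gT : finGroupType.
Implicit Types (G K A : {group gT}).

Lemma irr1_prime_index G K A r (i : Iirr G) :
    K <| G -> K \subset cfker 'chi_i -> A <| G -> K \subset A -> A^`(1)%g \subset K ->
    prime r -> #|G : A| = r ->
  'chi_i 1%g = 1 \/ 'chi_i 1%g = r%:R.
Proof.
move=> nsKG kerK nsAG sKA sA'K r_pr iGA.
have lin j : j \in irr_constt ('Res[A] 'chi_i) -> 'chi_j 1%g = 1.
  move=> cj; apply/lin_char1; rewrite lin_irr_der1 (subset_trans sA'K) //.
  apply: subset_trans (cfker_constt _ cj); last by rewrite cfRes_char ?irr_char.
  by rewrite cfker_Res ?irr_char ?(normal_sub nsAG) // subsetI sKA.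
have [/irrP[j resj] | [c injc resc]] := cfRes_prime_irr_cases i nsAG iGA r_pr.
  by left; rewrite -(cfRes1 A) resj lin // resj constt_irr inE.
right; rewrite -(cfRes1 A) resc sum_cfunE (eq_bigr (fun _ => 1)).
  by rewrite sumr_const card_ord.
move=> k _; apply: lin; rewrite irr_consttE resc cfdot_suml (bigD1 k) //= cfnorm_irr.
rewrite big1 ?addr0 ?oner_eq0 // => l ne_lk.
by rewrite cfdot_irr (inj_eq injc) (negPf ne_lk).
Qed.

(* A noncentral element of ['Z('chi_i)] would bring all commutators, hence [K^`(1)],
   into the kernel. *)
Lemma irr1_camina K (i : Iirr K) :
    K^`(1)%g \subset 'Z(K) ->
    {in K :\: 'Z(K), forall g,
      {in K^`(1)%g, forall z, exists2 y, y \in K & z = [~ g, y]%g}} ->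
    ~~ ('chi_i \is a linear_char) ->
  'chi_i 1%g ^+ 2 = #|K : 'Z(K)|%:R.
Proof.
move=> sK'Z camina nonlin.
have sZ: 'Z(K) \subset 'Z('chi_i)%CF by rewrite -cap_cfcenter_irr (bigcap_inf i).
suff defZ: 'Z('chi_i)%CF = 'Z(K).
  rewrite -defZ irr1_abelian_bound // sub_der1_abelian //.
  by rewrite (subset_trans sK'Z).
apply/eqP; rewrite eqEsubset sZ andbT; apply/subsetP=> g Zg; apply: contraR nonlin => notZg.
rewrite lin_irr_der1; apply/subsetP=> z K'z.
have Kg := subsetP (cfcenter_sub _) g Zg.
have nK x : x \in K -> x \in 'N(cfker 'chi_i).
  exact: subsetP (normal_norm (cfker_normal _)) x.
have [|y Ky ->] := camina g _ z K'z; first by rewrite inE notZg.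
have := mem_quotient (cfker 'chi_i) Zg; rewrite cfcenter_eq_center => /centerP[_ cg].
apply: coset_idr; first by rewrite groupR ?nK.
by rewrite morphR ?nK //; apply/eqP/commgP/cg; rewrite mem_quotient.
Qed.

End Degrees.

Lemma nonabelian_irr (gT : finGroupType) (G : {group gT}) :
  ~~ abelian G -> exists i : Iirr G, (~~ ('chi_i \is a linear_char))%R.
Proof.
move=> nabG; apply/existsP; rewrite -negb_forall; apply: contra nabG => /forallP.
exact: introT (char_abelianP G).
Qed.

Lemma upper_Fitting1 (gT : finGroupType) (G : {group gT}) : upper_Fitting G 1 = 'F(G).
Proof.
(* [G / 1] lives in a coset type, so the Fitting subgroup is transported along the injective
   [coset 1]. *)
have inj1: 'injm (@coset gT 1) by rewrite ker_coset.
rewrite /= -[_ / 1]/(coset 1 @* G) -injm_Fitting ?norms1 //.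
by apply: quotientGK; apply: normal1.
Qed.

(** * Frobenius groups with a non-nilpotent complement *)

Section FrobeniusTower.

Variables (gT : finGroupType) (G K H A : {group gT}).
Hypotheses (frobG : [Frobenius G = K ><| H]) (nilK : nilpotent K).
Hypotheses (nsAG : A <| G) (sKA : K \subset A) (sA'K : A^`(1) \subset K).
Hypothesis (nonnilH : ~~ nilpotent H).

Let nsKG : K <| G.
Proof. by have [defG _ _ _ _] := Frobenius_context frobG; have [] := sdprod_context defG. Qed.

Let sHG : H \subset G.
Proof. by have [defG _ _ _ _] := Frobenius_context frobG; have [] := sdprod_context defG. Qed.

Let isoHG : H \isog G / K.
Proof. by have [defG _ _ _ _] := Frobenius_context frobG; apply: sdprod_isog. Qed.

(** A nontrivial [h] in [H^](1)[acts on]K[without fixed points, so]K[lies in][~: K,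
    <[h]>][. This puts]K[first in]G^[(1)], and then, since [h] is in [G^](1)[too, in]G^[(2)]. *)
Lemma Frobenius_ker_sub_der2 : K \subset G^`(2).
Proof.
have: H^`(1) != 1.
  by apply: contraNneq nonnilH => /derG1P; apply: abelian_nil.
case/trivgPn=> h H'h nt_h; have Hh := subsetP (der_sub 1 H) h H'h.
have sK: K \subset [~: K, <[h]>].
  apply: sub_commg_cycle; first by rewrite (subsetP (normal_norm nsKG)) ?(subsetP sHG).
  by apply: (Frobenius_reg_ker frobG); rewrite !inE nt_h.
have sKG': K \subset G^`(1).
  apply: subset_trans sK _; rewrite derg1 commgSS ?(normal_sub nsKG) //.
  by rewrite cycle_subG (subsetP sHG).
apply: subset_trans sK _; rewrite dergSn commgSS //.
by rewrite cycle_subG (subsetP (dergS 1 sHG)).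
Qed.

(** From [G^](2) <= A^[(1) <= K] follows [G^](3) <= K^[(1)], which is abelian. Conversely
    [K <= G^](2)[, so]G^[(3) = 1] would make [K] abelian. *)
Lemma Frobenius_tower_derived_length :
    G^`(1) \subset A -> abelian K^`(1) -> ~~ abelian K ->
  solvable G /\ derived_length_is G 4.
Proof.
move=> sG'A abK' nabK; have sG2K: G^`(2) \subset K.
  by apply: subset_trans sA'K; apply: commgSS.
have G4: G^`(4) = 1.
  have sG3K': G^`(3) \subset K^`(1) := commgSS sG2K sG2K.
  by apply/trivgP; have/derG1P <- := abK'; apply: commgSS.
split; first by apply/derivedP; exists 4%N.
split=> // m lt_m4; apply: contraNneq nabK => Gm.
have sG k: G^`(k + m) \subset G^`(m).
  by elim: k => // k IH; apply: subset_trans IH; apply: der_subS.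
have G3: G^`(3) = 1.
  by apply/trivgP; have := sG (3 - m)%N; rewrite subnK // Gm.
apply/derG1P/trivgP; rewrite -G3.
by apply: commgSS; apply: Frobenius_ker_sub_der2.
Qed.

(** The series is [1], [K], [F2], [G]: [F2] contains [A] because [A / K] is abelian, and then
    [G / F2] is abelian; [F2] is not [G] because [G / K], isomorphic to [H], is not nilpotent. *)
Lemma Frobenius_tower_Fitting_height :
  G^`(1) \subset A -> Fitting_height_is G 3.
Proof.
move=> sG'A; have UF1: upper_Fitting G 1 = K.
  by rewrite upper_Fitting1 (Frobenius_Fitting frobG).
pose F2 := (coset K @*^-1 'F(G / K))%G.
have UF2: upper_Fitting G 2 = F2.
  by rewrite -[LHS]/(coset (upper_Fitting G 1) @*^-1 'F(G / upper_Fitting G 1)) UF1.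
have nsF2G: F2 <| G.
  by rewrite /= -{2}(quotientGK nsKG) cosetpre_normal Fitting_normal.
have sAF2: A \subset F2.
  rewrite /= -(quotientGK (normalS sKA (normal_sub nsAG) nsKG)) cosetpreSK.
  by rewrite Fitting_max ?quotient_normal // abelian_nil ?sub_der1_abelian.
have UF3: upper_Fitting G 3 = G.
  rewrite -[LHS]/(coset (upper_Fitting G 2) @*^-1 'F(G / upper_Fitting G 2)) UF2.
  rewrite nilpotent_Fitting ?quotientGK // abelian_nil // sub_der1_abelian //.
  exact: subset_trans sG'A sAF2.
have [_ _ ntH ltKG _] := Frobenius_context frobG.
split=> // [] [|[|[|]]] // _.
- by rewrite eq_sym (subG1_contra sHG).
- by rewrite UF1 (proper_neq ltKG).
rewrite UF2; apply: contraNneq nonnilH => F2G; rewrite (isog_nil isoHG).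
by move/(congr1 (fun B => B / K)): F2G; rewrite /= cosetpreK => <-; apply: Fitting_nil.
Qed.

Local Open Scope ring_scope.

Lemma has_nonprincipal_lin_irr : exists2 i : Iirr K, i != 0%R & 'chi_i \is a linear_char.
Proof.
have [_ ntK _ _ _] := Frobenius_context frobG.
have ltK'K: (K^`(1))%g \proper K := sol_der1_proper (nilpotent_sol nilK) (subxx _) ntK.
have /card_gt1P[i [j [lin_i lin_j ne_ij]]]: (1 < #|[pred i | 'chi[K]_i \is a linear_char]|)%N.
  by rewrite card_lin_irr indexg_gt1 proper_subn.
have [i0 | nz_i] := eqVneq i 0%R; last by exists i.
by exists j; rewrite // eq_sym -i0.
Qed.

Lemma Frobenius_tower_cd (r d : nat) :
    prime r -> #|G : A| = r -> ~~ abelian K ->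
    (forall i : Iirr K, 'chi_i \is a linear_char \/ ('chi_i 1%g = d%:R)%R) ->
  forall x, in_cd G x <->
    exists2 e, e \in [:: 1; r; #|H|; d * #|H|]%N & (x = e%:R)%R.
Proof.
move=> r_pr iGA nabK degK x; have [defG _ _ _ _] := Frobenius_context frobG.
have iGK: #|G : K| = #|H| by rewrite -divgS ?normal_sub // -(sdprod_card defG) mulKn.
have Ind1 (i : Iirr K): ('Ind[G] 'chi_i 1%g = #|H|%:R * 'chi_i 1%g)%R.
  by rewrite cfInd1 ?normal_sub // iGK.
have in_Ind (i : Iirr K): i != 0%R -> in_cd G (#|H|%:R * 'chi_i 1%g)%R.
  move=> nz_i; have /irrP[j Dj] := irr_induced_Frobenius_ker (FrobeniusWker frobG) nz_i.
  by exists j; rewrite -Dj Ind1.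
split=> [[j <-] | [e]].
  (* An irreducible character of [G] either is trivial on [K] or is induced from [K]. *)
  have [kerK | /Frobenius_Ind_irrP] := boolP (K \subset cfker 'chi_j).
    have [-> | ->] := irr1_prime_index nsKG kerK nsAG sKA sA'K r_pr iGA.
      by exists 1%N; rewrite ?inE ?eqxx.
    by exists r; rewrite ?inE ?eqxx ?orbT.
  case/(_ (FrobeniusWker frobG))=> i _ ->; rewrite Ind1.
  have [/lin_char1-> | ->] := degK i.
    by exists #|H|; rewrite ?mulr1 // !inE eqxx !orbT.
  by exists (d * #|H|)%N; rewrite -?natrM 1?mulnC // !inE eqxx !orbT.
have [i nz_i lin_i] := has_nonprincipal_lin_irr.
rewrite !inE => /or4P[] /eqP-> ->.
- by exists 0%R; rewrite irr0 cfun1E group1.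
(* Degree [r] is attained by inflating a nonlinear character of [G / K]. *)
- have /nonabelian_irr[k nlin]: ~~ abelian (G / K).
    by rewrite -(isog_abelian isoHG); apply: contra nonnilH; apply: abelian_nil.
  exists (mod_Iirr k); have Dk := mod_IirrE k nsKG.
  have kerK: K \subset cfker 'chi_(mod_Iirr k) by rewrite Dk cfker_mod.
  have [k1 | //] := irr1_prime_index nsKG kerK nsAG sKA sA'K r_pr iGA.
  by rewrite -cfMod_lin_charE // -Dk qualifE /= irr_char k1 eqxx in nlin.
- by have := in_Ind i nz_i; rewrite (lin_char1 lin_i) mulr1.
have [k nlin] := nonabelian_irr nabK.
have [/idPn[] // | Dk] := degK k.
rewrite mulnC natrM -Dk; apply: in_Ind.
by apply: contraNneq nlin => ->; rewrite irr0 cfun1_lin_char.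
Qed.

End FrobeniusTower.

(** * Semilinear maps and the group law on their indices *)

Section Construction.

Local Open Scope ring_scope.
Variables (F : finFieldType) (p q n s : nat) (w : F).
Let N := (n * s * q)%N.
Hypotheses (q_pr : prime q) (pcharF : p \in [pchar F]) (cardF : #|F| = (p ^ q)%N).
Hypotheses (q_dv : (q %| p - 1)%N) (N_dv : (N %| p ^ q - 1)%N).
Hypotheses (dv_ns : (p ^ q - 1 %| (p - 1) * (n * s))%N) (N_odd : odd N).
Hypotheses (n_gt1 : (1 < n)%N) (co_n : coprime n (p - 1)).
Hypothesis w_prim : N.-primitive_root w.

Let p_pr : prime p. Proof. by case/andP: pcharF. Qed.
Let N_gt0 : (0 < N)%N. Proof. exact: prim_order_gt0 w_prim. Qed.
Let q_dvN : (q %| N)%N. Proof. exact: dvdn_mull. Qed.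

Lemma expn_p_mod_q i : (p ^ i = 1 %[mod q])%N.
Proof.
rewrite -modnXm -(subnK (prime_gt0 p_pr)) -modnDml (eqP q_dv) add0n.
by rewrite modnXm exp1n.
Qed.

(** [p ^ q = 1] modulo [N]. *)
Lemma expn_p_mod i j : (i = j %[mod q] -> p ^ i = p ^ j %[mod N])%N.
Proof.
have redp k: (p ^ k = p ^ (k %% q) %[mod N])%N.
  rewrite {1}(divn_eq k q) expnD mulnC (mulnC (k %/ q)%N) expnM.
  have pq_gt0: (0 < p ^ q)%N by rewrite expn_gt0 prime_gt0.
  rewrite -modnMmr -modnXm -(subnK pq_gt0) -(modnDml (_ - _)) (eqP N_dv) add0n.
  by rewrite modnXm exp1n modnMmr muln1.
by move=> eq_ij; rewrite (redp i) eq_ij -redp.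
Qed.

Lemma frob_mod (x : F) i j : (i = j %[mod q])%N -> x ^+ (p ^ i) = x ^+ (p ^ j).
Proof.
have redx k: x ^+ (p ^ k) = x ^+ (p ^ (k %% q)).
  rewrite {1}(divn_eq k q) expnD exprM; congr (_ ^+ _).
  by elim: (k %/ q)%N => // l IH; rewrite mulSn expnD exprM -cardF expf_card.
by move=> eq_ij; rewrite (redx i) eq_ij -redx.
Qed.

(* [act e i \o act e j] is [act e k] with [k = i + p ^ i * j] modulo [N]. *)
Definition hmul (i j : nat) : 'I_N := Ordinal (ltn_pmod (i + p ^ i * j) N_gt0).

Lemma hmul_mod_q i j : (hmul i j = i + j %[mod q])%N.
Proof. by rewrite /= modn_dvdm // -modnDmr -modnMml expn_p_mod_q modnMml mul1n modnDmr. Qed.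

(** The weight [e] is 1 on the noncentral coordinates and 2 on the central one. *)
Definition act (e i : nat) (x : F) := w ^+ (e * i) * x ^+ (p ^ i).

Lemma actD e i : {morph act e i : x y / x + y}.
Proof.
move=> x y; rewrite /act exprDn_pchar ?mulrDr //.
apply/pnatP=> [|r r_pr]; first by rewrite expn_gt0 prime_gt0.
by rewrite Euclid_dvdX // dvdn_prime2 // => /andP[/eqP->].
Qed.

Lemma act0 e i : act e i 0 = 0.
Proof. by rewrite /act expr0n expn_eq0 gtn_eqF ?(prime_gt0 p_pr) // mulr0. Qed.

Lemma actN e i : {morph act e i : x / - x}.
Proof. by move=> x; apply/eqP; rewrite -addr_eq0 -actD addNr act0. Qed.

Lemma act_0 e x : act e 0 x = x.
Proof. by rewrite /act muln0 mul1r expr1. Qed.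

Lemma act_hmul e i j x : act e i (act e j x) = act e (hmul i j) x.
Proof.
have w_mod k: w ^+ (e * (k %% N)) = w ^+ (e * k).
  by rewrite !(mulnC e) !exprM (prim_expr_mod w_prim).
rewrite /act (frob_mod x (hmul_mod_q i j)) /= w_mod exprMn mulrA -!exprM -exprD -expnD.
by congr (w ^+ _ * x ^+ (p ^ _)); lia.
Qed.

(** This is why the centre needs weight 2: the maps then respect the term [a * b'] of the Heisenberg
    product. *)
Lemma act1M i x y : act 1 i x * act 1 i y = act 2 i (x * y).
Proof. by rewrite /act mulrACA -exprD -exprMn; congr (_ ^+ _ * _); lia. Qed.

Lemma hmulA (i j k : nat) : hmul i (hmul j k) = hmul (hmul i j) k.
Proof.
apply: val_inj => /=.
have -> : ((i + p ^ i * j) %% N = hmul i j)%N by [].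
rewrite -[RHS]modnDmr -(modnMml (p ^ hmul i j)) (expn_p_mod (hmul_mod_q i j)) modnMml modnDmr.
by rewrite /= modnDml -modnDmr modnMmr modnDmr expnD mulnDr addnA mulnA.
Qed.

Definition hone : 'I_N := Ordinal N_gt0.

Lemma hmul1 (i : 'I_N) : hmul hone i = i.
Proof. by apply: val_inj; rewrite /= add0n mul1n modn_small. Qed.

(** The index [- p^(-j) * j], with [N - 1] standing for -1 modulo [N] and [(q - 1) * j] for [-j]
    modulo [q]. *)
Definition hinv (j : nat) : 'I_N :=
  Ordinal (ltn_pmod ((N - 1) * (p ^ ((q - 1) * j) * j)) N_gt0).

Lemma hmulV (i : nat) : hmul (hinv i) i = hone.
Proof.
have Ei: (hinv i = (q - 1) * i %[mod q])%N.
  rewrite /= modn_dvdm // -modnMmr -(modnMml (p ^ _)) expn_p_mod_q modnMml mul1n modnMmr.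
  rewrite -modnMml -[in RHS]modnMml; congr (_ * _ %% _)%N.
  apply/eqP; rewrite -(eqn_modDr 1) !subnK // ?prime_gt0 //.
  by rewrite modnn; apply: q_dvN.
apply: val_inj; rewrite [LHS]/= -modnDmr -(modnMml (p ^ hinv i)) (expn_p_mod Ei).
rewrite modnMml modnDmr modnDml.
by rewrite -mulSnr -addn1 subnK // modnMr.
Qed.

Arguments hmul _ _ : simpl never.

(** * The semidirect product of the Heisenberg group and the index group *)

Definition heis_ext : Type := (F * F * F * 'I_N)%type.
HB.instance Definition _ := Finite.on heis_ext.

(** At index [hone] this multiplies unitriangular 3 by 3 matrices with [a], [b] next to the diagonal
    and [c] in the corner. *)
Definition gmul (x y : heis_ext) : heis_ext :=
  let: (a, b, c, i) := x in let: (a', b', c', j) := y in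
  (a + act 1 i a', b + act 1 i b', c + act 2 i c' + a * act 1 i b', hmul i j).

Definition gone : heis_ext := (0, 0, 0, hone).

Definition ginv (x : heis_ext) : heis_ext :=
  let: (a, b, c, i) := x in let j := hinv i in
  (- act 1 j a, - act 1 j b, act 2 j (a * b - c), j).

Lemma gmulA : associative gmul.
Proof.
move=> [[[a b] c] i] [[[a' b'] c'] j] [[[a'' b''] c''] k] /=.
rewrite !actD -(act1M i a') !act_hmul hmulA.
by congr (_, _, _, _); ring.
Qed.

Lemma gmul1 : left_id gone gmul.
Proof. by move=> [[[a b] c] i]; rewrite /= !act_0 hmul1 !add0r mul0r addr0. Qed.

Lemma gmulV : left_inverse gone ginv gmul.
Proof.
move=> [[[a b] c] i]; rewrite /= hmulV /gone !addNr actD actN -act1M.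
by congr (_, _, _, _); ring.
Qed.

Arguments gmul _ _ : simpl never.
Arguments ginv _ : simpl never.

HB.instance Definition _ := Finite_isGroup.Build heis_ext gmulA gmul1 gmulV.

Implicit Types (x y : heis_ext) (v : F * F * F) (a b c : F) (i j : 'I_N).

Lemma gmulE a b c a' b' c' i j :
  (((a, b, c, i) : heis_ext) * ((a', b', c', j) : heis_ext))%g =
  (a + act 1 i a', b + act 1 i b', c + act 2 i c' + a * act 1 i b', hmul i j) :> heis_ext.
Proof. by []. Qed.

Lemma index_mul x y : (x * y)%g.2 = hmul x.2 y.2.
Proof. by case: x y => [[[a b] c] i] [[[a' b'] c'] j]. Qed.

Lemma act_fixfree e i a : coprime e N -> act e i a = a -> a != 0 -> i = hone.
Proof.
move=> co_eN fix_a nz_a; have q_dv_i: (q %| i)%N.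
  (* Raise [fix_a] to the power [n * s]: as [p - 1] divides [p ^ i - 1], the exponent
     [(p ^ i - 1) * (n * s)] is a multiple of [p ^ q - 1] and kills [a]. *)
  have: w ^+ (e * i * (n * s)) = 1.
    apply: (mulIf (expf_neq0 (n * s) nz_a)); rewrite mul1r -[in RHS]fix_a exprMn -!exprM.
    congr (_ * _); move/dvdnP: dv_ns => [k kE].
    have pi_gt0: (0 < p ^ i)%N by rewrite expn_gt0 prime_gt0.
    rewrite -(subnK pi_gt0) mulnDl mul1n exprD; apply/esym.
    have /dvdnP[l ->]: (p - 1 %| p ^ i - 1)%N by rewrite -{2}(exp1n i) subn_exp dvdn_mulr.
    rewrite -mulnA kE mulnA (mulnC _ (p ^ q - 1)%N) exprM.
    have F_gt0: (0 < p ^ q)%N by rewrite expn_gt0 prime_gt0.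
    suff ->: a ^+ (p ^ q - 1) = 1 by rewrite expr1n mul1r.
    by apply: (mulIf nz_a); rewrite mul1r -exprSr -addn1 subnK // -cardF expf_card.
  move/eqP; rewrite -(prim_order_dvd w_prim) => N_dv_ei.
  have: (q * (n * s) %| e * i * (n * s))%N by rewrite [(q * _)%N]mulnC.
  rewrite dvdn_pmul2r; last by have := N_gt0; rewrite /N muln_gt0 => /andP[].
  rewrite Gauss_dvdr // coprime_sym; apply: coprime_dvdr co_eN; exact: q_dvN.
have: w ^+ (e * i) = 1.
  apply: (mulIf nz_a); rewrite mul1r -[in RHS]fix_a /act.
  have /frob_mod->: (i = 0 %[mod q])%N by rewrite mod0n; apply/eqP.
  by rewrite expr1.
move/eqP; rewrite -(prim_order_dvd w_prim) Gauss_dvdr 1?coprime_sym // => N_dv_i.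
by apply: val_inj; apply/eqP; rewrite /= eqn0Ngt; apply: contraL N_dv_i => /gtnNdvd->.
Qed.

(** * Subgroups and the Frobenius decomposition *)

Definition heis := [set x : heis_ext | x.2 == hone].
Definition heis_compl := [set x : heis_ext | x.1 == (0, 0, 0)].
Definition heis_center := [set x : heis_ext | (x.1.1 == (0, 0)) && (x.2 == hone)].

(* The subgroup of order [n] of the complement, on which the element of index 1
   acts without fixed points; it prevents the complement from being nilpotent. *)
Definition heis_compl_cyc := [set x : heis_ext | (x.1 == (0, 0, 0)) && (s * q %| x.2)%N].

Lemma mem_heis v i : (((v, i) : heis_ext) \in heis) = (i == hone).
Proof. by rewrite inE. Qed.

Lemma heis_group_set : group_set heis.
Proof.
apply/group_setP; split=> [|x y]; first by rewrite inE.
by rewrite !inE index_mul => /eqP-> /eqP->; rewrite hmul1.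
Qed.
Canonical heis_group := Group heis_group_set.

Lemma heis_compl_group_set : group_set heis_compl.
Proof.
apply/group_setP; split=> [|[v i] [v' j]]; first by rewrite inE.
by rewrite !inE => /eqP/=-> /eqP/=->; rewrite gmulE !act0 mul0r !addr0.
Qed.
Canonical heis_compl_group := Group heis_compl_group_set.

Lemma heis_compl_cyc_group_set : group_set heis_compl_cyc.
Proof.
apply/group_setP; split=> [|[v i] [v' j]]; first by rewrite inE eqxx dvdn0.
rewrite !inE => /andP[/eqP/=-> dv_i] /andP[/eqP/=-> dv_j].
rewrite gmulE !act0 mul0r !addr0 eqxx /= /hmul /= /dvdn modn_dvdm -/(dvdn _ _).
  by rewrite dvdn_add // dvdn_mull.
by rewrite /N -mulnA dvdn_mull.
Qed.
Canonical heis_compl_cyc_group := Group heis_compl_cyc_group_set.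

(** Its kernel serves as the normal subgroup [A] of index [q]; the successor form of the codomain
    gives it the group structure of the integers modulo [q]. *)
Definition index_mod_q x : 'I_q.-1.+1 := inZp x.2.

Lemma index_mod_qM : {morph index_mod_q : x y / (x * y)%g}.
Proof.
move=> x y; apply: val_inj; rewrite /= index_mul prednK ?prime_gt0 //.
by rewrite hmul_mod_q modnDm.
Qed.
Canonical index_mod_q_morphism := @Morphism _ _ setT index_mod_q (in2W index_mod_qM).

Lemma mem_ker_index_mod_q x : (x \in 'ker index_mod_q) = (q %| x.2)%N.
Proof.
by rewrite !inE /= -val_eqE /= prednK ?prime_gt0.
Qed.

Lemma index_ker_index_mod_q : #|[set: heis_ext] : 'ker index_mod_q| = q.
Proof.
have := card_morphim index_mod_q_morphism [set: heis_ext]; rewrite setIid => <-.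
rewrite (_ : (index_mod_q @* _)%g = setT) ?cardsT ?card_ord ?prednK ?prime_gt0 //.
apply/setP=> k; rewrite inE; have lt_kN: (k < N)%N.
  apply: leq_trans (ltn_ord k) _; rewrite prednK ?prime_gt0 //.
  by rewrite dvdn_leq //; apply: q_dvN.
apply/morphimP; exists ((0, 0, 0, Ordinal lt_kN) : heis_ext); rewrite ?inE //.
by apply: val_inj; rewrite /= modn_small.
Qed.

Lemma heis_normal : heis <| [set: heis_ext].
Proof.
rewrite /normal subsetT; apply/subsetP=> y _; rewrite inE; apply/subsetP=> _ /imsetP[x Hx ->].
move: Hx; rewrite !inE => /eqP x0; rewrite conjgE.
have <-: (y^-1 * y)%g.2 = hone by rewrite mulVg.
by rewrite !index_mul x0 hmul1.
Qed.

Lemma heis_compl_sdprod : heis ><| heis_compl = [set: heis_ext].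
Proof.
rewrite sdprodE.
- apply/setP=> -[v i]; rewrite inE; apply/imset2P.
  exists ((v, hone) : heis_ext) ((0, 0, 0, i) : heis_ext); rewrite ?inE //.
  by case: v => [[a b] c]; rewrite gmulE !act0 mulr0 !addr0 hmul1.
- by rewrite (subset_trans _ (normal_norm heis_normal)) ?subsetT.
apply/trivgP/subsetP=> -[v i]; rewrite !inE => /andP[/eqP/=-> /eqP/=->].
exact: eqxx.
Qed.

Lemma heis_neq1 : heis :!=: 1%g.
Proof.
apply/trivgPn; exists ((1, 0, 0, hone) : heis_ext); first by rewrite inE.
by apply/eqP=> -[] /eqP; rewrite oner_eq0.
Qed.

Lemma q_lt_N : (q < N)%N.
Proof.
have := N_gt0; rewrite /N muln_gt0 => /andP[ns_gt0 q_gt0].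
rewrite -[X in (X < _)%N]mul1n ltn_pmul2r // (leq_trans n_gt1) // leq_pmulr //.
by move: ns_gt0; rewrite muln_gt0 => /andP[].
Qed.

Lemma heis_compl_neq1 : heis_compl :!=: 1%g.
Proof.
apply/trivgPn; exists ((0, 0, 0, Ordinal q_lt_N) : heis_ext); first by rewrite inE.
by apply/eqP=> -[] /eqP; rewrite gtn_eqF ?prime_gt0.
Qed.

Lemma heis_compl_Frobenius : [Frobenius [set: heis_ext] = heis ><| heis_compl].
Proof.
apply/(Frobenius_semiregularP heis_compl_sdprod heis_neq1 heis_compl_neq1) => -[v i].
rewrite !inE /= => /andP[nt_i /eqP v0]; rewrite {}v0 in nt_i *.
apply/trivgP/subsetP=> -[[[a b] c] j] /setIP[]; rewrite inE /= => /eqP-> /cent1P.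
rewrite /commute !gmulE !act_0 !(add0r, addr0, mulr0, mul0r) => -[fa fb fc _].
have nz_i: i != hone by apply: contraNneq nt_i => ->.
have co2N: coprime 2 N by rewrite coprime2n.
apply/set1P; congr (_, _, _, _); apply/eqP; apply: contraNT nz_i => nz; apply/eqP.
- exact: act_fixfree (coprime1n _) (esym fa) nz.
- exact: act_fixfree (coprime1n _) (esym fb) nz.
- exact: act_fixfree co2N (esym fc) nz.
Qed.

(** * Commutators, centre and character degrees of the Heisenberg group *)

Lemma heis_commg a b c a' b' c' :
  [~ (a, b, c, hone) : heis_ext, (a', b', c', hone) : heis_ext]%g =
  (0, 0, a * b' - a' * b, hone).
Proof.
(* Checking [x * y = y * x * [~ x, y]] avoids computing inverses. *)
apply: (mulgI (((a', b', c', hone) : heis_ext) * ((a, b, c, hone) : heis_ext))%g).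
rewrite -commgC !gmulE.
by rewrite !hmul1 !act_0; congr (_, _, _, _); ring.
Qed.

Lemma heis_centerE : 'Z(heis) = heis_center.
Proof.
apply/setP=> -[[[a b] c] i]; rewrite !inE /=; apply/andP/andP=> -[].
  move=> /eqP-> /centP cx; split=> //.
  (* Commuting with these two elements forces [a = 0] and [b = 0] respectively. *)
  have := cx ((0, 1, 0, hone) : heis_ext); have := cx ((1, 0, 0, hone) : heis_ext).
  rewrite !inE eqxx => /(_ isT)/commgP + /(_ isT)/commgP.
  rewrite !heis_commg => /eqP[] + /eqP[]; rewrite !(mulr0, mul0r, mulr1, mul1r, subr0, sub0r).
  by move/eqP; rewrite oppr_eq0 => /eqP-> ->.
move=> /eqP[-> ->] /eqP->; split=> //; apply/centP=> -[[[a' b'] c'] j].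
rewrite mem_heis => /eqP->; apply/commgP; rewrite heis_commg.
by rewrite mul0r mulr0 subrr.
Qed.

Lemma heis_der1_sub : (heis^`(1) \subset 'Z(heis))%g.
Proof.
rewrite gen_subG /= heis_centerE.
apply/subsetP=> _ /imset2P[[[[a b] c] i] [[[a' b'] c'] j] + + ->].
by rewrite !mem_heis => /eqP-> /eqP->; rewrite heis_commg inE eqxx.
Qed.

Lemma heis_nonabelian : ~~ abelian heis.
Proof.
apply/negP=> /centsP/(_ ((1, 0, 0, hone) : heis_ext)).
rewrite inE => /(_ isT ((0, 1, 0, hone) : heis_ext)); rewrite inE => /(_ isT)/commgP.
rewrite heis_commg mul1r mul0r subr0 => /eqP[] /eqP.
by rewrite oner_eq0.
Qed.

Lemma heis_camina :
  {in heis :\: 'Z(heis), forall g,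
    {in heis^`(1)%g, forall z, exists2 y, y \in heis & z = [~ g, y]%g}}.
Proof.
rewrite heis_centerE => -[[[a b] c] i]; rewrite !inE /= => /andP[nz_ab /eqP i0].
move: nz_ab; rewrite {}i0 eqxx andbT => nz_ab.
move=> [[[a' b'] d] j] /(subsetP heis_der1_sub).
rewrite heis_centerE inE => /andP[/eqP/=[-> ->] /eqP/=->].
(* The equation [a * b' - a' * b = d] is solved by dividing by whichever of [a], [b] is nonzero. *)
have [a0 | nz_a] := eqVneq a 0.
  have nz_b: b != 0 by apply: contraNneq nz_ab => ->; rewrite a0.
  exists ((- d / b, 0, 0, hone) : heis_ext); first by rewrite inE.
  by rewrite heis_commg a0 mul0r divfK // sub0r opprK.
exists ((0, d / a, 0, hone) : heis_ext); first by rewrite inE.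
by rewrite heis_commg mul0r subr0 mulrC divfK.
Qed.

Lemma card_heis : #|heis| = (#|F| * #|F| * #|F|)%N.
Proof.
rewrite -!card_prod -cardsT -(card_imset _ (f := fun v => ((v, hone) : heis_ext)));
  last by move=> u v [].
apply: eq_card => -[v i]; rewrite inE; apply/eqP/imsetP=> [/= -> | [u _ [_ ->]] //].
by exists v.
Qed.

Lemma card_heis_center : #|heis_center| = #|F|.
Proof.
rewrite -cardsT -(card_imset _ (f := fun c => ((0, 0, c, hone) : heis_ext)));
  last by move=> u v [].
apply: eq_card => -[[[a b] c] i]; rewrite inE.
apply/andP/imsetP=> /= [[/eqP[-> ->] /eqP->] | ].
  by exists c.
by case=> u _ [-> -> _ ->].
Qed.

Lemma heis_pgroup : p.-group heis.
Proof. by rewrite /pgroup card_heis cardF !pnatM !pnatX !pnat_id. Qed.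

(** The centre has index [(p ^ q) ^ 2], which [irr1_camina] makes the square of any nonlinear
    degree. *)
Lemma heis_irr1 (i : Iirr heis) :
  'chi_i \is a linear_char \/ 'chi_i 1%g = (p ^ q)%:R.
Proof.
have [|nlin] := boolP ('chi_i \is a linear_char); [by left | right].
apply/eqP; rewrite -(eqrXn2 (isT : 0 < 2)%N) ?ler0n ?char1_ge0 ?irr_char //; apply/eqP.
rewrite (irr1_camina heis_der1_sub heis_camina nlin) -natrX; congr _%:R.
rewrite -divgS ?center_sub // /= heis_centerE card_heis card_heis_center cardF.
by rewrite mulnK // expn_gt0 prime_gt0.
Qed.

(** * Non-nilpotence of the complement *)

Lemma heis_compl_cyc_neq1 : heis_compl_cyc != 1%g.
Proof.
have lt_sqN: (s * q < N)%N.
  have := N_gt0; rewrite /N -mulnA muln_gt0 => /andP[_ sq_gt0].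
  by rewrite -[X in (X < _)%N]mul1n ltn_pmul2r.
apply/trivgPn; exists ((0, 0, 0, Ordinal lt_sqN) : heis_ext).
  by rewrite inE /= eqxx dvdnn.
apply/eqP=> -[] /eqP; have := N_gt0; rewrite /N -mulnA muln_gt0 => /andP[_].
by rewrite lt0n => /negPf->.
Qed.

Lemma N_gt1 : (1 < N)%N.
Proof. by apply: leq_ltn_trans q_lt_N; apply: prime_gt0. Qed.

Let tau : heis_ext := (0, 0, 0, Ordinal N_gt1).

(** For such [i] the twist [p ^ i] is 1 modulo [N]. *)
Lemma hmul_add i (j : nat) : (q %| i)%N -> hmul i j = ((i + j) %% N)%N :> nat.
Proof.
move=> q_dv_i; have iq: (i = 0 %[mod q])%N by rewrite mod0n; apply/eqP.
by rewrite /hmul /= -modnDmr -modnMml (expn_p_mod iq) modnMml mul1n modnDmr.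
Qed.

Lemma heis_compl_cyc_norm_tau : tau \in 'N(heis_compl_cyc).
Proof.
(* Conjugating by [tau^-1] gives [y * tau = tau * x], so the index of [y] is [p * i] modulo [N],
   again a multiple of [s * q]. *)
rewrite -groupV inE; apply/subsetP=> _ /imsetP[[v i] + ->].
rewrite !inE => /andP[/eqP/= -> sq_dv_i].
set y := (_ ^ _)%g.
have yE: (y * tau)%g = (tau * ((0, 0, 0, i) : heis_ext))%g.
  by rewrite /y conjgE invgK !mulgA mulgKV.
case: y yE => [[[a b] c] k]; rewrite !gmulE !act0 !(addr0, mulr0) => -[-> -> -> kE].
rewrite eqxx /=; have {}kE: hmul k 1 = hmul 1 i by apply: val_inj.
have q_dv_i: (q %| i)%N by apply: dvdn_trans sq_dv_i; rewrite dvdn_mull.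
have q_dv_k: (q %| k)%N.
  have := hmul_mod_q k 1; rewrite kE hmul_mod_q addnC => /eqP.
  by rewrite eqn_modDr /dvdn (eqP q_dv_i) eq_sym.
move/(congr1 (@nat_of_ord N))/eqP: kE; rewrite hmul_add //= addnC expn1 eqn_modDl => kE.
have sq_dvN: (s * q %| N)%N by rewrite /N -mulnA dvdn_mull.
by rewrite /dvdn -(modn_dvdm k sq_dvN) (eqP kE) modn_dvdm // -/(dvdn _ _) dvdn_mull.
Qed.

(** Commuting with [tau] means [N] divides [(p - 1) * i]. With [i = t * (s * q)], [n] divides
    [(p - 1) * t], hence [t] by coprimality, so [N] divides [i]. *)
Lemma heis_compl_cyc_fixfree_tau : 'C_heis_compl_cyc[tau] = 1%g.
Proof.
apply/trivgP/subsetP=> -[v i] /setIP[]; rewrite inE => /andP[/eqP/= -> sq_dv_i].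
move/cent1P; rewrite /commute !gmulE !act0 !(addr0, mulr0) => -[].
rewrite -[LHS]/(val (hmul i 1)) -[RHS]/(val (hmul 1 i)) => /val_inj iE.
have q_dv_i: (q %| i)%N by apply: dvdn_trans sq_dv_i; rewrite dvdn_mull.
move/(congr1 (@nat_of_ord N))/eqP: iE; rewrite hmul_add //= addnC expn1 eqn_modDl.
rewrite -{1}(mul1n i) eq_sym -[X in (X * i)%N == _ %[mod _]](subnKC (ltnW (prime_gt1 p_pr))).
rewrite mulnDl -[X in _ == X %[mod _]]addn0 eqn_modDl mod0n => N_dv_pi.
have n_dv_t: (n %| i %/ (s * q))%N.
  have sq_gt0: (0 < s * q)%N by have := N_gt0; rewrite /N -mulnA muln_gt0 => /andP[].
  rewrite -(Gauss_dvdr _ co_n) -(dvdn_pmul2r sq_gt0) -mulnA divnK //.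
  by rewrite (mulnA n).
have N_dv_i: (N %| i)%N by rewrite -[X in (X %| _)%N]mulnA -(divnK sq_dv_i) dvdn_mul.
suff ->: i = hone by rewrite inE; apply/eqP.
by apply: val_inj; apply/eqP; rewrite /= eqn0Ngt; apply: contraL N_dv_i => /gtnNdvd->.
Qed.

Lemma heis_compl_not_nilpotent : ~~ nilpotent heis_compl.
Proof.
apply: contraNN heis_compl_cyc_neq1 => nilH; apply/eqP.
have [ntau regtau] := (heis_compl_cyc_norm_tau, heis_compl_cyc_fixfree_tau).
apply: (nilpotent_fixfree nilH _ _ ntau regtau); last by rewrite inE.
by apply/subsetP=> x; rewrite !inE => /andP[].
Qed.

(** * The normal subgroup of index [q], and assembly *)

Lemma heis_sub_ker_index_mod_q : heis \subset 'ker index_mod_q.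
Proof. by apply/subsetP=> x; rewrite mem_ker_index_mod_q inE => /eqP->. Qed.

(** Indices divisible by [q] multiply by addition modulo [N], so commutators have index 0. *)
Lemma ker_index_mod_q_der1 : (('ker index_mod_q)^`(1) \subset heis)%g.
Proof.
rewrite gen_subG; apply/subsetP=> _ /imset2P[x y + + ->].
rewrite !mem_ker_index_mod_q => q_dv_x q_dv_y.
have: [~ x, y]%g \in 'ker index_mod_q by rewrite groupR ?mem_ker_index_mod_q.
rewrite mem_ker_index_mod_q inE; have := congr1 snd (commgC x y).
rewrite (index_mul x y) (index_mul (y * x)%g) (index_mul y x).
move: (x.2) (y.2) ([~ x, y]%g.2) q_dv_x q_dv_y => i j k q_dv_i q_dv_j.
move/(congr1 (@nat_of_ord N))/eqP.
have q_dv_ji: (q %| hmul j i)%N by rewrite /dvdn hmul_mod_q -/(dvdn _ _) dvdn_add.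
rewrite (hmul_add j q_dv_i) (hmul_add k q_dv_ji) (hmul_add i q_dv_j) modnDml (addnC i).
rewrite -[X in X == _ %[mod _]]addn0 eqn_modDl mod0n => + _.
by rewrite modn_small // eq_sym.
Qed.

Lemma der1_ker_index_mod_q : ([set: heis_ext]^`(1) \subset 'ker index_mod_q)%g.
Proof.
rewrite der1_min ?normal_norm ?ker_normal //.
rewrite cyclic_abelian // prime_cyclic // card_quotient ?normal_norm ?ker_normal //.
by rewrite index_ker_index_mod_q.
Qed.

Lemma card_heis_compl : #|heis_compl| = N.
Proof.
have := sdprod_card heis_compl_sdprod; rewrite cardsT !card_prod card_ord card_heis.
by move/eqP; rewrite eqn_pmul2l ?cardF ?muln_gt0 ?expn_gt0 ?prime_gt0 // => /eqP.
Qed.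

Lemma heis_tower :
  exists (gT : finGroupType) (G : {group gT}),
    solvable G /\ derived_length_is G 4 /\ Fitting_height_is G 3 /\
    (forall x : algC, in_cd G x <->
      exists2 e, e \in [:: 1; q; N; p ^ q * N]%N & x = e%:R).
Proof.
exists heis_ext, [set: heis_ext]%G; have nilK := pgroup_nil heis_pgroup.
have nsA := ker_normal index_mod_q_morphism; have sKA := heis_sub_ker_index_mod_q.
have abK' : abelian heis^`(1)%g.
  by apply: abelianS heis_der1_sub (center_abelian _).
have [sol dl] := Frobenius_tower_derived_length heis_compl_Frobenius
  ker_index_mod_q_der1 heis_compl_not_nilpotent der1_ker_index_mod_q abK' heis_nonabelian.
split=> //; split=> //; split.
  exact: (Frobenius_tower_Fitting_height heis_compl_Frobenius nilK nsA sKA ker_index_mod_q_der1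
    heis_compl_not_nilpotent der1_ker_index_mod_q).
rewrite -card_heis_compl.
exact: (Frobenius_tower_cd heis_compl_Frobenius nilK nsA sKA ker_index_mod_q_der1
  heis_compl_not_nilpotent q_pr index_ker_index_mod_q heis_nonabelian heis_irr1).
Qed.

End Construction.

(** * Roots of unity in finite fields, and the conclusion *)

Lemma finField_has_prim_root (F : finFieldType) (d : nat) :
  (d %| #|F| - 1)%N -> exists w : F, (d.-primitive_root w)%R.
Proof.
move=> d_dv; have F_gt0: (0 < #|F| - 1)%N by rewrite subn_gt0 card_finNzRing_gt1.
(* The nonzero elements are [#|F| - 1] distinct roots of unity of that order, enough to include a
   primitive one; a power of it has order [d]. *)
pose rs := enum (predC1 (0%R : F)).
have unity_rs: all ((#|F| - 1)%N.-unity_root)%R rs.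
  apply/allP=> x; rewrite mem_enum unity_rootE => nz_x; apply/eqP/(mulIf nz_x).
  by rewrite mul1r -exprSr -addn1 subnK ?expf_card // ltnW ?card_finNzRing_gt1.
have size_rs: (#|F| - 1 <= size rs)%N by rewrite -cardE cardC1 subn1.
have /hasP[z _ z_prim] := has_prim_root F_gt0 unity_rs (enum_uniq _) size_rs.
by exists (z ^+ ((#|F| - 1) %/ d))%R; apply: dvdn_prim_root.
Qed.

Theorem theorem3p1 (p q : nat) :
  prime p -> prime q -> odd q -> (q %| p - 1)%N ->
  exists (gT : finGroupType) (G : {group gT}),
    solvable G /\ derived_length_is G 4 /\ Fitting_height_is G 3 /\
    (forall x : algC, in_cd G x <->
      exists2 d : nat,
        d \in [:: 1%N; q;
                  (((p ^ q - 1) %/ (p - 1))`_q^' * (p - 1)`_q * q)%N;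
                  (p ^ q * ((p ^ q - 1) %/ (p - 1))`_q^' * (p - 1)`_q * q)%N]
        & x = (d%:R)%R).
Proof.
move=> p_pr q_pr q_odd q_dv.
have [F pcharF cardF] := pPrimePowerField p_pr (prime_gt0 q_pr).
have N_dv := repunit_order_dvd p_pr q_pr q_odd q_dv.
have [w w_prim]: exists w : F,
    ((((p ^ q - 1) %/ (p - 1))`_q^' * (p - 1)`_q * q)%N.-primitive_root w)%R.
  by apply: finField_has_prim_root; rewrite cardF.
rewrite -!mulnA [X in [:: _; _; X; _]]mulnA [X in [:: _; _; _; p ^ q * X]%N]mulnA.
exact: (heis_tower q_pr pcharF cardF q_dv N_dv (repunit_dvd_order p_pr q_pr q_odd q_dv)
  (odd_repunit_order p_pr q_pr q_odd q_dv) (repunit_part_gt1 p_pr q_pr q_odd q_dv)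
  (coprime_repunit_part_pred p_pr q_pr q_odd q_dv) w_prim).
Qed.
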